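(* Let $m\ge 3$ and $n\ge 3$. Kemeny's constant of the complete flower graph $F_n(K_m)$ is $$\mathscr K(F_n(K_m))=\frac{(m-1)\left(-12n+m(n^2+6n-1)\right)}{6m}.$$
   Context: For a connected graph $H$ with vertex set $\{1,\dots,N\}$ and Laplacian matrix $L$, the resistance distance between vertices $i,j$ is $r_H(i,j)=(e_i-e_j)^T L^\dagger (e_i-e_j)$, where $e_i$ is the $i$th standard unit vector and $L^\dagger$ is the Moore–Penrose pseudoinverse of $L$. Kemeny's constant of (the simple random walk on) a connected graph $H$ is given by $\mathscr K(H)=\frac{1}{4|E(H)|}\sum_{i,j\in V(H)} d_i d_j\, r_H(i,j)$, where $d_i$ is the degree of $i$ in $H$ and the sum is over ordered pairs; this formula may be taken as the definition. Complete flower graph: for $m\ge3$, $n\ge 3$, fix two distinct vertices $x,y$ of the complete graph $K_m$ (the choice is irrelevant up to isomorphism). $F_n(K_m)$ is obtained from $n$ vertex-disjoint copies $G_1,\dots,G_n$ of $K_m$, with $x_i,y_i$ the copies of $x,y$ in $G_i$, by identifying $y_i$ with $x_{i+1}$ for $1\le i<n$ and $y_n$ with $x_1$. *)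

(* Defs.v *)
From HB Require Import structures.
From mathcomp Require Import all_boot all_order all_algebra.

Set Implicit Arguments.
Unset Strict Implicit.
Unset Printing Implicit Defensive.

Import Order.TTheory GRing.Theory Num.Theory.
Local Open Scope ring_scope.

Record sgraph := SGraph {
  vertex :> finType;
  adj : rel vertex;
  adj_sym : symmetric adj;
  adj_irrefl : irreflexive adj }.

Definition connected_graph (G : sgraph) : Prop :=
  (0 < #|G|)%N /\ forall u v : G, connect (@adj G) u v.

Definition degree (G : sgraph) (v : G) : nat := #|[set w | adj v w]|.

Definition edges (G : sgraph) : {set {set G}} :=
  [set [set p.1; p.2] | p in [set p : G * G | adj p.1 p.2]].

(* Matrices are indexed by 'I_#|G|, with vertices numbered by enum_val and
   enum_rank. *)
Definition laplacian (R : nzRingType) (G : sgraph) : 'M[R]_#|G| :=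
  \matrix_(i, j) (if i == j then (degree (enum_val i))%:R
                  else - (adj (enum_val i) (enum_val j))%:R).

Definition penrose (R : nzRingType) (m n : nat)
    (A : 'M[R]_(m, n)) (B : 'M[R]_(n, m)) : bool :=
  [&& A *m B *m A == A, B *m A *m B == B,
      (A *m B)^T == A *m B & (B *m A)^T == B *m A].

Lemma mulmx_tr_eq0 (R : realFieldType) (n : nat) (u : 'rV[R]_n) :
  u *m u^T = 0 -> u = 0.
Proof.
move/matrixP/(_ 0 0); rewrite !mxE => /eqP.
rewrite psumr_eq0 => [/allP u0|i _]; last by rewrite mxE -expr2 sqr_ge0.
apply/rowP => i; apply/eqP; have := u0 i (mem_index_enum i).
by rewrite !mxE mulf_eq0 orbb.
Qed.

Lemma gram_unit (R : realFieldType) (r n : nat) (F : 'M[R]_(r, n)) :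
  row_free F -> F *m F^T \in unitmx.
Proof.
move=> freeF; rewrite -row_free_unit; apply/row_freeP.
suff: kermx (F *m F^T) == 0 by rewrite kermx_eq0 => /row_freeP.
apply/eqP/row_matrixP => i; rewrite row0.
set u := row i _; have: u *m (F *m F^T) = 0.
  by rewrite /u -row_mul mulmx_ker row0.
move=> uFF; have uF0 : u *m F = 0.
  apply: mulmx_tr_eq0; rewrite trmx_mul.
  by rewrite mulmxA -(mulmxA u) uFF mul0mx.
by apply: (row_free_inj freeF); rewrite uF0 mul0mx.
Qed.

Lemma penrose_exists (R : realFieldType) (m n : nat) (A : 'M[R]_(m, n)) :
  exists B, penrose A B.
Proof.
have [r [C [F [defA uF uC]]]] : exists r (C : 'M[R]_(m, r)) (F : 'M[R]_(r, n)),
    [/\ A = C *m F, F *m F^T \in unitmx & C^T *m C \in unitmx].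
  exists (\rank A), (col_base A), (row_base A); split.
  - by rewrite mulmx_base.
  - exact/gram_unit/row_base_free.
  - rewrite -{2}[col_base A]trmxK; apply: gram_unit.
    by rewrite /row_free mxrank_tr; apply: col_base_full.
set P := invmx (F *m F^T); set Q := invmx (C^T *m C).
have FP : F *m F^T *m P = 1%:M by rewrite mulmxV.
have QC : Q *m (C^T *m C) = 1%:M by rewrite mulVmx.
have PT : P^T = P by rewrite trmx_inv trmx_mul trmxK.
have QT : Q^T = Q by rewrite trmx_inv trmx_mul trmxK.
pose B := F^T *m P *m Q *m C^T.
have AB : A *m B = C *m Q *m C^T.
  by rewrite defA /B !mulmxA -(mulmxA C F) -(mulmxA C _ P) FP mulmx1.
have BA : B *m A = F^T *m P *m F.
  by rewrite defA /B -!mulmxA (mulmxA C^T) (mulmxA Q) QC mul1mx.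
exists B; apply/and4P; split; apply/eqP.
- by rewrite AB {1}defA -!mulmxA [C^T *m _]mulmxA [Q *m _]mulmxA QC mul1mx defA.
- by rewrite BA /B !mulmxA -(mulmxA _ F) -(mulmxA _ (F *m _)) FP mulmx1.
- by rewrite AB !trmx_mul trmxK QT mulmxA.
- by rewrite BA !trmx_mul trmxK PT mulmxA.
Qed.

Lemma penrose_unique (R : realFieldType) (m n : nat) (A : 'M[R]_(m, n))
    (B B' : 'M[R]_(n, m)) : penrose A B -> penrose A B' -> B = B'.
Proof.
move=> /and4P[/eqP b1 /eqP b2 /eqP b3 /eqP b4].
move=> /and4P[/eqP c1 /eqP c2 /eqP c3 /eqP c4].
have AB : A *m B = A *m B'.
  by rewrite -b3 -{1}c1 -(mulmxA (A *m B')) trmx_mul b3 c3 mulmxA b1.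
have BA : B *m A = B' *m A.
  by rewrite -b4 -{1}c1 !mulmxA -(mulmxA (B *m A)) trmx_mul b4 c4 -mulmxA
       [A *m (B *m A)]mulmxA b1.
by rewrite -b2 BA -mulmxA AB mulmxA c2.
Qed.

Definition moore_penrose (R : realFieldType) (m n : nat)
    (A : 'M[R]_(m, n)) : 'M[R]_(n, m) := xchoose (penrose_exists A).

Lemma moore_penroseP (R : realFieldType) (m n : nat) (A : 'M[R]_(m, n)) :
  penrose A (moore_penrose A).
Proof. exact: xchooseP. Qed.

Definition resistance (R : realFieldType) (G : sgraph) (u v : G) : R :=
  let d : 'cV[R]_#|G| :=
    delta_mx (enum_rank u) 0 - delta_mx (enum_rank v) 0 in
  (d^T *m moore_penrose (laplacian R G) *m d) 0 0.

Definition kemeny (R : realFieldType) (G : sgraph) : R :=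
  (4 * #|edges G|%:R)^-1 *
  \sum_(u : G) \sum_(v : G)
    (degree u)%:R * (degree v)%:R * resistance R u v.

Section CompleteGraph.
Variable m : nat.

Definition complete_adj : rel 'I_m := fun a b => a != b.

Lemma complete_sym : symmetric complete_adj.
Proof. by move=> a b; rewrite /complete_adj eq_sym. Qed.

Lemma complete_irrefl : irreflexive complete_adj.
Proof. by move=> a; rewrite /complete_adj eqxx. Qed.

Definition complete_graph : sgraph := SGraph complete_sym complete_irrefl.

Lemma complete_connected : (0 < m)%N -> connected_graph complete_graph.
Proof.
move=> m_gt0; split=> [|u v]; first by rewrite card_ord.
by have [->|nuv] := eqVneq u v; [apply: connect0 | apply: connect1].
Qed.

End CompleteGraph.

Section Flower.
Variables (G : sgraph) (x y : G) (n : nat).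

(* (i, v) is the copy of the vertex v in the i-th copy of G; indices are
   cyclic, since ordS maps the last element of 'I_n to the first. *)
Definition glued : rel ('I_n * G) := fun p q =>
  [&& p.2 == y, q.2 == x & q.1 == ordS p.1].

Definition identified : rel ('I_n * G) :=
  connect (fun p q => glued p q || glued q p).

Lemma identified_refl : reflexive identified.
Proof. by move=> p; apply: connect0. Qed.

Lemma identified_sym : symmetric identified.
Proof.
by apply: sym_connect_sym => p q /=; rewrite orbC.
Qed.

Lemma identified_trans : transitive identified.
Proof. exact: connect_trans. Qed.

Definition identified_equiv :=
  EquivRel identified identified_refl identified_sym identified_trans.

Definition flower_vertex := {eq_quot identified_equiv}%qT.

HB.instance Definition _ := EqQuotient.on flower_vertex.
HB.instance Definition _ := Finite.copy flower_vertex
  (can_type (EquivQuot.ereprK (encD := defaultEncModRel identified_equiv))).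

(* Distinct classes are adjacent when they have adjacent representatives in a
   common copy.  The condition P != Q only matters for n = 1, where identifying
   y with x could create loops; for n <= 2 parallel edges may be merged. *)
Definition flower_adj : rel flower_vertex := fun P Q =>
  (P != Q) && [exists p : 'I_n * G, exists q : 'I_n * G,
    [&& \pi_flower_vertex p == P, \pi_flower_vertex q == Q,
        p.1 == q.1 & adj p.2 q.2]]%qT.

Lemma flower_sym : symmetric flower_adj.
Proof.
have sub P Q : flower_adj P Q -> flower_adj Q P.
  case/andP=> nPQ /existsP[p /existsP[q /and4P[pP qQ e1 e2]]].
  rewrite /flower_adj eq_sym nPQ; apply/existsP; exists q; apply/existsP.
  by exists p; rewrite pP qQ eq_sym e1 adj_sym e2.
by move=> P Q; apply/idP/idP; apply: sub.
Qed.

Lemma flower_irrefl : irreflexive flower_adj.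
Proof. by move=> P; rewrite /flower_adj eqxx. Qed.

Definition flower : sgraph := SGraph flower_sym flower_irrefl.

Lemma flower_connected :
  (0 < n)%N -> connected_graph G -> connected_graph flower.
Proof.
move=> n_gt0 [_ cG]; pose pi : 'I_n * G -> flower := \pi_flower_vertex%qT.
have in_copy i u v : connect (@adj flower) (pi (i, u)) (pi (i, v)).
  case/connectP: (cG u v) => p; elim: p u => [|w p IHp] u /= => [_ ->|].
    exact: connect0.
  case/andP=> uw pw lw; apply: connect_trans (IHp _ pw lw).
  have [->|npi] := eqVneq (pi (i, u)) (pi (i, w)); first exact: connect0.
  apply: connect1; rewrite /= /flower_adj npi /=; apply/existsP; exists (i, u).
  by apply/existsP; exists (i, w); rewrite !eqxx.
have symc : connect_sym (@adj flower) := sym_connect_sym (@adj_sym flower).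
have base k (lt_kn : (k < n)%N) u :
    connect (@adj flower) (pi (Ordinal n_gt0, x)) (pi (Ordinal lt_kn, u)).
  elim: k => [|k IHk] in lt_kn u *.
    by rewrite (bool_irrelevance lt_kn n_gt0); apply: in_copy.
  apply: connect_trans (in_copy _ x u).
  have <- : pi (Ordinal (ltnW lt_kn), y) = pi (Ordinal lt_kn, x).
    apply/eqP; rewrite eqmodE; apply: connect1.
    by rewrite /glued /= !eqxx /= -val_eqE /= modn_small ?eqxx.
  exact: IHk.
split=> [|P Q]; first by apply/card_gt0P; exists (pi (Ordinal n_gt0, x)).
elim/quotW: P => -[[i ltin] u]; elim/quotW: Q => -[[j ltjn] v].
by apply: connect_trans (base _ ltjn v); rewrite symc; apply: base.
Qed.

End Flower.

(* Main.v *)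
(* A complete graph K_m is electrically a star whose m legs have resistance 1/m,
   so the flower is a cycle of 2n resistors 1/m, with the internal vertices of
   each copy hanging by legs 1/m from every other node. This suggests an explicit
   resistance rho; a symmetric kernel vanishing on the diagonal whose Laplacian
   in the first variable is h(P) - 2 [P = Q] is the resistance distance, and rho
   has this property because the second difference of k (2n - k) / 2n on the
   cycle of length 2n is 2 [k = 0] - 1/n. As every vertex of a copy has degree
   m - 1, degree-weighted sums over the flower are m - 1 times sums over the
   disjoint union of the copies. *)
Require Import Defs.
From mathcomp Require Import all_boot all_order all_algebra.
From mathcomp Require Import zify ring lra.

Set Implicit Arguments.
Unset Strict Implicit.
Unset Printing Implicit Defensive.

Import Order.TTheory GRing.Theory Num.Theory.
Local Open Scope ring_scope.

(** * Degree sums, Laplacians and potentials on an arbitrary graph *)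

Lemma sum_degree (G : sgraph) : (\sum_(u : G) degree u = 2 * #|edges G|)%N.
Proof.
pose arcs := [set p : G * G | adj p.1 p.2].
pose ends (p : G * G) := [set p.1; p.2].
transitivity #|arcs|.
  rewrite -sum1_card (eq_bigl (fun p : G * G => adj p.1 p.2)); last first.
    by move=> p; rewrite inE.
  rewrite -(pair_big_dep xpredT (fun u v => adj u v) (fun _ _ => 1%N)) /=.
  by apply: eq_bigr => u _; rewrite sum1_card /degree cardsE.
(* Arcs are grouped by the edge they span; each fibre consists of the two orientations. *)
rewrite -sum1_card (partition_big_imset ends) /= -/(edges G).
rewrite mulnC -sum_nat_const; apply: eq_bigr => _ /imsetP[[u v] uv ->].
rewrite inE /= in uv; have nuv : u != v.
  by apply: contraTneq uv => ->; rewrite adj_irrefl.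
rewrite sum1dep_card (_ : [set _ | _] = [set (u, v); (v, u)]); last first.
  apply/setP=> -[a b]; rewrite !inE /ends /= !xpair_eqE.
  apply/andP/orP => [[ab /eqP e]|].
    have /set2P ha : a \in [set u; v] by rewrite -e set21.
    have /set2P hb : b \in [set u; v] by rewrite -e set22.
    case: ha hb ab => -> [] ->; rewrite ?adj_irrefl ?eqxx //; by [left|right].
  by case=> /andP[/eqP-> /eqP->]; rewrite ?uv // adj_sym uv setUC.
by rewrite cards2 xpair_eqE (negbTE nuv).
Qed.

Definition lap (R : realFieldType) (G : sgraph) (f : G -> R) (u : G) : R :=
  \sum_(w | adj u w) (f u - f w).

Lemma laplacian_mul (R : realFieldType) (G : sgraph) (f : G -> R) :
  laplacian R G *m (\col_i f (enum_val i)) = \col_i lap f (enum_val i).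
Proof.
apply/colP=> i; rewrite !mxE /lap sumrB sumr_const -mulr_natl.
have -> : #|(fun w => adj (enum_val i) w)| = degree (enum_val i).
  by rewrite /degree cardsE.
rewrite (bigD1 i) //= !mxE eqxx; congr (_ + _).
rewrite [in RHS]big_mkcond (big_enum_val (A := G)) /=.
rewrite [in RHS](bigD1 i) //= adj_irrefl add0r -sumrN.
apply: eq_bigr => j nji; rewrite !mxE eq_sym (negbTE nji).
by case: adj; rewrite ?mulN1r // mulr0n oppr0 mul0r.
Qed.

Lemma laplacian_sym (R : realFieldType) (G : sgraph) :
  (laplacian R G)^T = laplacian R G.
Proof.
apply/matrixP=> i j; rewrite !mxE eq_sym adj_sym.
by case: eqP => // ->.
Qed.

(** With d = L F and X the pseudoinverse of L, symmetry of L and L X L = L give d^T X d = F^T L X L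
    F = F^T d, which is the potential drop. *)
Lemma resistance_potential (R : realFieldType) (G : sgraph) (f : G -> R)
    (u v : G) :
  (forall w, lap f w = (w == u)%:R - (w == v)%:R) ->
  resistance R u v = f u - f v.
Proof.
move=> lapf; rewrite /resistance.
set d : 'cV[R]__ := _ - _; set F : 'cV[R]_#|G| := \col_i f (enum_val i).
have Ld : laplacian R G *m F = d.
  rewrite laplacian_mul; apply/colP=> i; rewrite !mxE lapf !andbT.
  by rewrite !(can2_eq (@enum_valK _) (@enum_rankK _)).
have /and4P[/eqP LXL _ _ _] := moore_penroseP (laplacian R G).
rewrite -Ld trmx_mul laplacian_sym -!mulmxA (mulmxA (laplacian R G)).
rewrite (mulmxA (_ *m _) (laplacian R G)) LXL Ld.
rewrite /d mulmxBr !mxE; congr (_ - _).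
  rewrite (bigD1 (enum_rank u)) //= !mxE enum_rankK !eqxx mulr1.
  by rewrite big1 ?addr0 // => j /negbTE nj; rewrite !mxE nj mulr0.
rewrite (bigD1 (enum_rank v)) //= !mxE enum_rankK !eqxx mulr1.
by rewrite big1 ?addr0 // => j /negbTE nj; rewrite !mxE nj mulr0.
Qed.

(* Half the difference of two columns of rho is the potential of a unit
   current between the corresponding vertices. *)
Lemma resistance_kernel (R : realFieldType) (G : sgraph) (rho : G -> G -> R)
    (h : G -> R) (u v : G) :
  (forall w, rho w w = 0) -> (forall w z, rho w z = rho z w) ->
  (forall w z, lap (rho^~ z) w = h w - (w == z)%:R *+ 2) ->
  resistance R u v = rho u v.
Proof.
move=> rho0 rhoC lap_rho.
rewrite (@resistance_potential _ _ (fun w => (rho w v - rho w u) / 2)).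
  by rewrite !rho0 (rhoC v); field.
move=> w; transitivity ((lap (rho^~ v) w - lap (rho^~ u) w) / 2).
  by rewrite /lap -sumrB mulr_suml; apply: eq_bigr => z _; field.
by rewrite !lap_rho; field.
Qed.

(** * Reducing sums over the flower to sums over the disjoint copies *)

Section FlowerQuotient.
Variables (G : sgraph) (x y : G) (n : nat).
Hypotheses (nxy : x != y) (n_gt2 : (2 < n)%N).

Definition flower_pi (p : 'I_n * G) : flower x y n :=
  (\pi_(flower_vertex x y n) p)%qT.

(** Canonical representative of a class: as x != y, the pair (ordS i, x) replacing (i, y) cannot be
    moved further. *)
Definition glue_normal (p : 'I_n * G) : 'I_n * G :=
  if p.2 == y then (ordS p.1, x) else p.

Lemma glue_normal_ne p : (glue_normal p).2 != y.
Proof. by rewrite /glue_normal; case: ifP => // /negbT. Qed.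

(** A gluing step does not change the normal form, and every pair is identified with its normal form
    in at most one step. *)
Lemma flower_piE p q :
  (flower_pi p == flower_pi q) = (glue_normal p == glue_normal q).
Proof.
rewrite /flower_pi eqmodE /=.
have toN r : identified x y r (glue_normal r).
  rewrite /glue_normal; case: eqP => [ry|_]; last exact: identified_refl.
  by apply: connect1; rewrite /glued /= ry !eqxx.
apply/idP/eqP => [/connectP[s]|e].
  elim: s p => [|r s IHs] p /= => [_ -> //|/andP[pr rs] lq].
  rewrite -(IHs r rs lq) /glue_normal; case: p r pr {IHs rs lq} => i a [j b].
  rewrite /glued /=.
  by case/orP=> /and3P[/eqP-> /eqP-> /eqP->]; rewrite eqxx (negbTE nxy).
apply: identified_trans (toN p) _; rewrite e identified_sym; exact: toN.
Qed.

Lemma flower_piK p : flower_pi p = flower_pi (glue_normal p).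
Proof.
apply/eqP; rewrite flower_piE {2}/glue_normal.
by rewrite (negbTE (glue_normal_ne p)).
Qed.

Lemma flower_piP (P : flower x y n) : exists i a, a != y /\ P = flower_pi (i, a).
Proof.
elim/quotW: P => p; case E: (glue_normal p) => [i a]; exists i, a.
by rewrite -E -flower_piK; move: (glue_normal_ne p); rewrite E.
Qed.

(** Within one copy only x and y could merge, and this would force [ordS i = i]. *)
Lemma flower_pi_copy_inj i : injective (fun a => flower_pi (i, a)).
Proof.
move=> a b /eqP; rewrite flower_piE /glue_normal /=.
have Sni : (ordS i == i) = false.
  apply/eqP => /(congr1 val) /= e; have ltin := ltn_ord i.
  have [lt|ge] := ltnP i.+1 n; first by rewrite modn_small // in e; lia.
  have En : i.+1 = n by lia.
  rewrite En modnn in e; lia.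
have [->|nay] := eqVneq a y; have [->|nby] := eqVneq b y => //.
- by rewrite xpair_eqE Sni.
- by rewrite xpair_eqE eq_sym Sni.
by rewrite xpair_eqE => /andP[_ /eqP].
Qed.

Lemma ordS2_neq (i : 'I_n) : ordS (ordS i) != i.
Proof.
apply/eqP => /(congr1 val) /= e; have ltin := ltn_ord i.
have [lt|ge] := ltnP i.+1 n.
  rewrite (modn_small lt) in e.
  have [lt2|ge2] := ltnP i.+2 n; first by rewrite modn_small // in e; lia.
  have En : i.+2 = n by lia.
  rewrite En modnn in e; lia.
have En : i.+1 = n by lia.
by rewrite En modnn modn_small in e; lia.
Qed.

(* Two edges of different copies have different images; this fails for n = 2,
   where the copies of an edge from x to y have the same end points. *)
Lemma flower_copy_uniq i j a b a' b' : a != b -> a' != b' ->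
  flower_pi (i, a) = flower_pi (j, a') ->
  flower_pi (i, b) = flower_pi (j, b') -> i = j.
Proof.
move=> nab nab' /eqP; rewrite flower_piE => ea /eqP; rewrite flower_piE => eb.
move: ea eb; rewrite /glue_normal /=.
have S2 (k : 'I_n) : (ordS (ordS k) == k) = false := negbTE (ordS2_neq k).
case: (eqVneq a y) nab => [->|_]; case: (eqVneq b y) => [_|_];
  case: (eqVneq a' y) nab' => [->|_]; case: (eqVneq b' y) => [_|_];
  rewrite ?eqxx // => nab' nab; rewrite !xpair_eqE.
all: case/andP=> /eqP e1 _ /andP[/eqP e2 _] //.
  (* In the two cases left, y is an end of each edge but at opposite ends of the matching, so i and
     j would be successors of each other. *)
  by have := S2 i; rewrite e1 -e2 eqxx.
by have := S2 i; rewrite e2 -e1 eqxx.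
Qed.

Lemma flower_adjP P Q :
  reflect (exists p w, [/\ flower_pi p = P, adj p.2 w & flower_pi (p.1, w) = Q])
          (@adj (flower x y n) P Q).
Proof.
apply: (iffP andP) => [[_ /existsP[p /existsP[[j w]]]]|[[i a] [w [<- aw <-]]]].
  by case/and4P=> /eqP pP /eqP <- /= /eqP <- ?; exists p, w.
split; last first.
  apply/existsP; exists (i, a); apply/existsP; exists (i, w).
  by rewrite -/(flower_pi _) !eqxx.
by apply: contraTneq aw => /flower_pi_copy_inj ->; rewrite adj_irrefl.
Qed.

(** Every arc of the flower lifts to exactly one arc of one copy: [flower_copy_uniq] fixes the copy
    and [flower_pi_copy_inj] the two ends. *)
Lemma sum_flower_adj (V : nmodType) (F : flower x y n -> V) P :
  \sum_(Q | adj P Q) F Q =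
  \sum_(p | flower_pi p == P) \sum_(w | adj p.2 w) F (flower_pi (p.1, w)).
Proof.
rewrite pair_big_dep /=.
rewrite (partition_big (fun q : _ * G => flower_pi (q.1.1, q.2)) (adj P)) /=.
  apply: eq_bigr => Q /flower_adjP[[i a] [b [/= ia ab ib]]].
  have nab : a != b by apply: contraTneq ab => ->; rewrite adj_irrefl.
  rewrite (big_pred1 ((i, a), b)) /= ?ib // => -[[j a'] b'] /=.
  apply/andP/eqP => [[/andP[/eqP ja ab'] /eqP jb]|[-> -> ->]]; last first.
    by rewrite ia ib !eqxx.
  have nab' : a' != b' by apply: contraTneq ab' => ->; rewrite adj_irrefl.
  rewrite -ia in ja; rewrite -ib in jb.
  have Eji := flower_copy_uniq nab' nab ja jb.
  move: ja jb; rewrite Eji => /flower_pi_copy_inj <-.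
  by move/flower_pi_copy_inj <-.
by case=> p w /andP[/eqP pP aw]; apply/flower_adjP; exists p, w.
Qed.

Lemma degree_flower P :
  degree P = \sum_(p | flower_pi p == P) degree p.2.
Proof.
rewrite /degree -sum1_card (eq_bigl (adj P)) => [|Q]; last by rewrite inE.
rewrite sum_flower_adj; apply: eq_bigr => p _.
by rewrite -sum1_card; apply: eq_bigl => w; rewrite inE.
Qed.

Lemma sum_degree_flower (R : nzRingType) (F : flower x y n -> R) :
  \sum_P (degree P)%:R * F P = \sum_p (degree p.2)%:R * F (flower_pi p).
Proof.
rewrite (partition_big flower_pi xpredT) //=; apply: eq_bigr => P _.
rewrite degree_flower natr_sum mulr_suml.
by apply: eq_bigr => p /eqP ->.
Qed.

Lemma lap_flower (R : realFieldType) (F : flower x y n -> R) P :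
  lap F P = \sum_(p | flower_pi p == P) lap (fun w => F (flower_pi (p.1, w))) p.2.
Proof.
rewrite /lap sum_flower_adj; apply: eq_bigr => -[i a] /= /eqP <-.
by [].
Qed.

Lemma sum_flower_fiber (V : nmodType) (F : 'I_n * G -> V) i a : a != y ->
  \sum_(p | flower_pi p == flower_pi (i, a)) F p =
  F (i, a) + (if a == x then F (ord_pred i, y) else 0).
Proof.
move=> nay; rewrite (bigD1 (i, a)) //=; congr (_ + _).
have fib p : (flower_pi p == flower_pi (i, a)) && (p != (i, a)) =
    (a == x) && (p == (ord_pred i, y)).
  rewrite flower_piE /glue_normal /= (negbTE nay); case: p => j b /=.
  rewrite !xpair_eqE (eq_sym a); case: (eqVneq b y) => [->|nby].
    rewrite xpair_eqE (eq_sym y) (negbTE nay) andbF !andbT andbC.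
    by rewrite (can2_eq (@ordSK _) (@ord_predK _)).
  by rewrite xpair_eqE andbN !andbF.
rewrite (eq_bigl _ _ fib); case: eqP => _ /=; last by rewrite big_pred0.
by rewrite big_pred1_eq.
Qed.
End FlowerQuotient.

(** * Resistances on a cycle of 2n unit resistors *)

Section Chord.
Variables (R : realFieldType) (n : nat).
Hypothesis n_gt0 : (0 < n)%N.

(* Resistance between the positions s, t <= 2n of a cycle of 2n unit
   resistors, positions 0 and 2n being the same. *)
Definition chord (s t : nat) : R :=
  `|s%:R - t%:R| - (s%:R - t%:R) ^+ 2 / (2 * n%:R).

Let nR : n%:R != 0 :> R.
Proof. by rewrite pnatr_eq0 -lt0n. Qed.

Let natr_double k : k.*2%:R = 2 * k%:R :> R.
Proof. by rewrite -mul2n natrM. Qed.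

Lemma chordC s t : chord s t = chord t s.
Proof. by rewrite /chord distrC -sqrrN opprB. Qed.

Lemma chordxx s : chord s s = 0.
Proof. by rewrite /chord subrr normr0 expr0n mul0r subr0. Qed.

(** The absolute value has second difference 2 at its kink and 0 elsewhere; the quadratic term
    contributes the constant 1/n. *)
Lemma chord_diff2 s t :
  chord s.+2 t + chord s t - chord s.+1 t *+ 2 =
  (s.+1 == t)%:R *+ 2 - n%:R^-1.
Proof.
have -> : chord s.+2 t + chord s t - chord s.+1 t *+ 2 =
    `|s%:R + 2 - t%:R| + `|s%:R - t%:R| - `|s%:R + 1 - t%:R| *+ 2 - n%:R^-1.
  by rewrite /chord -addn2 -(addn1 s) !natrD; field.
congr (_ - _); have [lt|gt|<-] := ltngtP s.+1 t; rewrite /= ?mulr0n ?mulr1n ?mul0rn.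
- have : (s.+2)%:R <= t%:R :> R by rewrite ler_nat.
  rewrite -addn2 natrD => le.
  by rewrite !ler0_norm; lra.
- have : t%:R <= s%:R :> R by rewrite ler_nat.
  by move=> le; rewrite !ger0_norm; lra.
rewrite -(addn1 s) natrD /= [X in _ + X - _]distrC.
by rewrite !ger0_norm; lra.
Qed.

(** The expression k (2n - k) / 2n is invariant under replacing k by 2n - k. *)
Lemma chord_wrap t : (t <= n.*2)%N -> chord n.*2 t = chord 0 t.
Proof.
move=> le; have : t%:R <= n.*2%:R :> R by rewrite ler_nat.
rewrite /chord natr_double => le'; have t0 : 0 <= t%:R :> R := ler0n _ _.
rewrite [in RHS]distrC !ger0_norm ?subr0 //; last lra.
by field.
Qed.

(** This is the negated second difference centred at the cut position 2i, which is both the start of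
    copy i and the end of the preceding copy. *)
Lemma chord_diff2_cut (i : 'I_n) t : (t < n.*2)%N ->
  chord i.*2 t + chord (ord_pred i).*2.+2 t
    - (chord i.*2.+1 t + chord (ord_pred i).*2.+1 t) =
  n%:R^-1 - (i.*2 == t)%:R *+ 2.
Proof.
move=> ltt; have ltin := ltn_ord i.
have [i0|i_gt0] := posnP i; last first.
  have -> : nat_of_ord (ord_pred i) = i.-1.
    rewrite /= -subn1 addnC -addnBA // modnDl modn_small ?subn1 //; lia.
  have Ei : (i.-1.*2.+2 = i.*2)%N by lia.
  have := chord_diff2 i.-1.*2.+1 t; rewrite Ei; lra.
(* For i = 0 the preceding copy is the last one: its end 2n wraps to 0, and the other neighbour of 0
   is 2n - 1. *)
have -> : nat_of_ord (ord_pred i) = n.-1 by rewrite /= i0 modn_small; lia.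
have -> : (n.-1.*2.+2 = n.*2)%N by lia.
have -> : (n.-1.*2.+1 = n.*2 - 1)%N by lia.
rewrite i0 double0 (chord_wrap (ltnW ltt)).
have [t0|t_gt0] := posnP t.
  rewrite t0 chordxx /chord natrB ?double_gt0 // natr_double !subr0 normr1.
  have n1 : 1 <= n%:R :> R by rewrite ler1n.
  by rewrite ger0_norm /=; [field | lra].
have t1 : 1 <= t%:R :> R by rewrite ler1n.
have : (t + 1)%:R <= n.*2%:R :> R by rewrite ler_nat addn1.
have -> : (0 == t)%N = false by apply/eqP; lia.
rewrite /chord natrB ?double_gt0 // natr_double natrD => tn.
rewrite sub0r normrN [`|1 - _|]distrC !ger0_norm; try lra.
rewrite mulr0n mul0rn. by field.
Qed.

Lemma sum_natr k : \sum_(j < k) j%:R = k%:R * (k%:R - 1) / 2 :> R.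
Proof.
elim: k => [|k IHk]; first by rewrite big_ord0; field.
by rewrite big_ord_recr /= IHk -addn1 natrD; field.
Qed.

Lemma sum_sqr_dist (a : R) k :
  \sum_(j < k) (a - j%:R) ^+ 2 =
  k%:R * a ^+ 2 - a * k%:R * (k%:R - 1) + k%:R * (k%:R - 1) * (2 * k%:R - 1) / 6.
Proof.
elim: k => [|k IHk]; first by rewrite big_ord0; field.
by rewrite big_ord_recr /= IHk -addn1 natrD; field.
Qed.

Lemma sum_dist i k : (i <= k)%N ->
  \sum_(j < k) `|i%:R - j%:R| =
  (i%:R * (i%:R + 1) + (k%:R - i%:R) * (k%:R - i%:R - 1)) / 2 :> R.
Proof.
elim: k => [|k IHk]; first by rewrite leqn0 => /eqP ->; rewrite big_ord0; field.
rewrite leq_eqVlt ltnS => /orP[/eqP-> {IHk i}|le_ik]; last first.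
  rewrite big_ord_recr /= IHk // distrC ger0_norm ?subr_ge0 ?ler_nat //.
  by rewrite -addn1 natrD; field.
transitivity (\sum_(j < k.+1) (k.+1%:R - j%:R) : R).
  by apply: eq_bigr => j _; rewrite ger0_norm // subr_ge0 ler_nat ltnW.
rewrite sumrB sumr_const card_ord sum_natr -mulr_natr.
by rewrite -addn1 natrD; field.
Qed.

(** By rotation the sum cannot depend on i: the terms in i of the linear and the quadratic sums
    cancel. *)
Lemma sum_chord_odd (i : 'I_n) :
  \sum_(j < n) chord i.*2.+1 j.*2.+1 = (n%:R ^+ 2 - 1) / 3.
Proof.
have odd2 k : k.*2.+1%:R = k%:R * 2 + 1 :> R.
  by rewrite -addn1 natrD natr_double mulrC.
transitivity (\sum_(j < n) (`|i%:R - j%:R| * 2 : R)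
    - \sum_(j < n) (i%:R - j%:R) ^+ 2 * (2 / n%:R)).
  rewrite -sumrB; apply: eq_bigr => j _; rewrite /chord !odd2.
  have -> : i%:R * 2 + 1 - (j%:R * 2 + 1) = (i%:R - j%:R) * 2 :> R by ring.
  by rewrite normrM (ger0_norm (ler0n _ 2)); field.
rewrite -!mulr_suml sum_sqr_dist sum_dist ?(ltnW (ltn_ord i)) //.
by field.
Qed.
End Chord.

(** * Degrees and Laplacian of the complete graph *)

Lemma degree_complete m (a : complete_graph m) : degree a = m.-1.
Proof.
rewrite /degree (_ : [set w | adj a w] = ~: [set a]) ?cardsC1 ?card_ord //.
by apply/setP=> w; rewrite !inE eq_sym.
Qed.

Lemma lap_complete (R : realFieldType) m (f : complete_graph m -> R) a :
  lap f a = m%:R * f a - \sum_w f w.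
Proof.
transitivity (\sum_w (f a - f w)).
  rewrite /lap [RHS](bigD1 a) //= subrr add0r.
  by apply: eq_bigl => w; rewrite /= /complete_adj eq_sym.
by rewrite sumrB sumr_const card_ord mulr_natl.
Qed.

Lemma sum_if2 (R : realFieldType) (T : finType) (x y : T) (a b c : R) :
  x != y ->
  \sum_w (if w == x then a else if w == y then b else c) =
  a + b + (#|T|%:R - 2) * c.
Proof.
move=> nxy.
transitivity (\sum_w (c + (if w == x then a - c else 0)
                       + (if w == y then b - c else 0))).
  apply: eq_bigr => w _; case: (eqVneq w x) => [->|_].
    by rewrite (negbTE nxy); ring.
  by case: ifP => _; ring.
rewrite !big_split /= sumr_const -!big_mkcond !big_pred1_eq -mulr_natl.
ring.
Qed.

(** * The explicit resistance of the complete flower and its total *)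

Section CompleteFlower.
Variables (R : realFieldType) (m n : nat) (x y : complete_graph m).
Hypotheses (nxy : x != y) (n_gt2 : (2 < n)%N).

Let n_gt0 : (0 < n)%N. Proof. exact: leq_trans n_gt2. Qed.
Let nR : n%:R != 0 :> R. Proof. by rewrite pnatr_eq0 -lt0n. Qed.
Let mR : m%:R != 0 :> R.
Proof. by rewrite pnatr_eq0; case: m x => // -[]. Qed.

Let pi := @flower_pi (complete_graph m) x y n.
Let piE := @flower_piE (complete_graph m) x y n nxy.

Definition inner (p : 'I_n * 'I_m) := (p.2 != x) && (p.2 != y).

(** Place on the cycle of 2n resistors: all internal vertices of copy i are sent to the centre 2i +
    1 of its star. The vertex y of the last copy gets 2n rather than 0. *)
Definition position (p : 'I_n * 'I_m) : nat :=
  if p.2 == x then p.1.*2 else if p.2 == y then p.1.*2.+2 else p.1.*2.+1.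

(* The term in p == q is restricted to internal vertices: for a cut vertex
   there is no leg, and the chord between its two representatives is 0. *)
Definition copy_resistance (p q : 'I_n * 'I_m) : R :=
  ((inner p)%:R + (inner q)%:R - (inner p && (p == q))%:R *+ 2
   + chord R n (position p) (position q)) / m%:R.

Lemma position_le p : (position p <= n.*2)%N.
Proof.
rewrite /position; have := ltn_ord p.1.
by case: ifP => _; [|case: ifP => _]; lia.
Qed.

Lemma position_odd i q : (i.*2.+1 == position q)%N = inner q && (i == q.1 :> nat).
Proof.
rewrite /position /inner; case: (q.2 == x) => /=; first by apply/eqP; lia.
case: (q.2 == y) => /=; first by apply/eqP; lia.
by apply/eqP/eqP; lia.
Qed.

Lemma copy_resistanceC p q : copy_resistance p q = copy_resistance q p.
Proof.
rewrite /copy_resistance chordC; congr (_ / _); congr (_ - _ *+ 2 + _).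
  by rewrite addrC.
by rewrite [q == p]eq_sym; case: eqP => [->|_]; rewrite ?andbF.
Qed.

(** The two representatives of a cut vertex are not internal, and their positions agree up to the
    wrap from 2n to 0. *)
Lemma copy_resistance_normal p q :
  copy_resistance (glue_normal x y p) q = copy_resistance p q.
Proof.
rewrite /glue_normal; case: p => i a; case: eqP => //= ->.
have nyx : y == x = false by rewrite eq_sym (negbTE nxy).
rewrite /copy_resistance /inner /= !eqxx nyx /=; congr ((_ + _) / _).
rewrite /position /= !eqxx nyx.
have [lt|ge] := ltnP i.+1 n; first by rewrite modn_small.
have En : i.+1 = n by have := ltn_ord i; lia.
have -> : (i.*2.+2 = n.*2)%N by lia.
by rewrite En modnn chord_wrap // position_le.
Qed.

(** The choice of representatives does not affect the value, by [flower_resistanceE]. *)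
Definition flower_resistance (P Q : flower x y n) : R :=
  copy_resistance (repr P) (repr Q).

Lemma glue_normal_repr p :
  glue_normal x y (repr (pi p)) = glue_normal x y p.
Proof. by apply/eqP; rewrite -piE; apply/eqP; exact: reprK. Qed.

Lemma flower_resistanceE p q :
  flower_resistance (pi p) (pi q) = copy_resistance p q.
Proof.
rewrite /flower_resistance -copy_resistance_normal glue_normal_repr.
rewrite copy_resistance_normal copy_resistanceC.
by rewrite -copy_resistance_normal glue_normal_repr copy_resistance_normal
  copy_resistanceC.
Qed.

Lemma flower_resistancexx P : flower_resistance P P = 0.
Proof.
rewrite /flower_resistance /copy_resistance eqxx andbT chordxx.
by rewrite mulr2n; field.
Qed.

Lemma flower_resistanceC P Q : flower_resistance P Q = flower_resistance Q P.
Proof. exact: copy_resistanceC. Qed.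

(** On the cycle, x and y of the copy are the neighbours of the centre 2i + 1, where the other m - 2
    vertices sit, so the sum is m times the central value plus the second difference there. *)
Lemma sum_chord_copy i t :
  \sum_w chord R n (position (i, w)) t =
  m%:R * chord R n i.*2.+1 t + (i.*2.+1 == t)%:R *+ 2 - n%:R^-1.
Proof.
transitivity (\sum_w (if w == x then chord R n i.*2 t else
    if w == y then chord R n i.*2.+2 t else chord R n i.*2.+1 t)).
  by apply: eq_bigr => w _; rewrite /position /=; do 2?case: ifP.
rewrite sum_if2 // card_ord; have := chord_diff2 R n_gt0 i.*2 t.
set a := chord _ _ _ _; lra.
Qed.

Lemma sum_inner_copy i : \sum_w (inner (i, w))%:R = m%:R - 2 :> R.
Proof.
transitivity (\sum_(w : 'I_m) (if w == x then 0 else if w == y then 0 else 1) : R).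
  by apply: eq_bigr => w _; rewrite /inner /=; do 2?case: eqP.
by rewrite sum_if2 // card_ord; ring.
Qed.

Lemma sum_inner_eq i q :
  \sum_w (inner (i, w) && ((i, w) == q))%:R = (i.*2.+1 == position q)%:R :> R.
Proof.
rewrite position_odd (bigD1 q.2) //= big1 ?addr0.
  case: q => j b; rewrite /= xpair_eqE eqxx andbT val_eqE.
  by rewrite /inner.
move=> w nw; case: q nw => j b /= nw.
by rewrite xpair_eqE (negbTE nw) !andbF.
Qed.

Lemma sum_copy_resistance i q :
  \sum_w copy_resistance (i, w) q =
  (m%:R - 2) / m%:R + (inner q)%:R + chord R n i.*2.+1 (position q)
  - (n%:R * m%:R)^-1.
Proof.
rewrite -mulr_suml 3!big_split /= sumrN sumr_const card_ord -[_ *+ m]mulr_natl.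
rewrite sum_chord_copy sumrMnl sum_inner_eq sum_inner_copy.
by field; rewrite mR nR.
Qed.

Lemma lap_flower_resistance : exists h : flower x y n -> R, forall P Q,
  lap (flower_resistance^~ Q) P = h P - (P == Q)%:R *+ 2.
Proof.
(* These values remain once the terms in Q cancel: an internal vertex sees one copy, a cut vertex
   two, with 1/n from [chord_diff2_cut]. A cut vertex may be represented through x or through y,
   hence the test against both. *)
exists (fun P => if (repr P).2 \in [:: x; y]
  then n%:R^-1 - 2 * (m%:R - 2) / m%:R + 2 / (n%:R * m%:R)
  else 2 / m%:R + (n%:R * m%:R)^-1) => P Q.
have [i [a [nay ->]]] := flower_piP nxy P.
have [j [b [nby ->]]] := flower_piP nxy Q.
have normal k c : c != y -> glue_normal x y (k, c) = (k, c).
  by rewrite /glue_normal /= => /negbTE ->.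
have -> : ((repr (pi (i, a))).2 \in [:: x; y]) = (a == x).
  have := congr1 snd (glue_normal_repr (i, a)); rewrite normal //= => {2}<-.
  by rewrite !inE /glue_normal orbC; case: (_ == y); rewrite /= ?eqxx.
have lap_copy k c : lap (fun w => flower_resistance (pi (k, w)) (pi (j, b))) c =
    m%:R * copy_resistance (k, c) (j, b)
    - ((m%:R - 2) / m%:R + (inner (j, b))%:R
       + chord R n k.*2.+1 (position (j, b)) - (n%:R * m%:R)^-1).
  rewrite lap_complete flower_resistanceE -sum_copy_resistance.
  by congr (_ - _); apply: eq_bigr => w _; rewrite flower_resistanceE.


rewrite (lap_flower nxy n_gt2).
rewrite sum_flower_fiber //= !lap_copy.
rewrite piE !normal // xpair_eqE /copy_resistance {lap_copy normal}.
have pos_lt : (position (j, b) < n.*2)%N.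
  rewrite /position /= (negbTE nby); have := ltn_ord j.
  by case: ifP => _; lia.
case: (eqVneq a x) => [->|nax]; last first.
  have -> : inner (i, a) by rewrite /inner /= nax.
  have -> : position (i, a) = i.*2.+1.
    by rewrite /position /= (negbTE nax) (negbTE nay).
  by rewrite addr0 xpair_eqE /=; field; rewrite mR nR.
(* As b != y, only the pair (i, x) can have position 2i, so equality with Q is read off from
   positions. *)
have -> : (i == j) && (x == b) = (i.*2 == position (j, b))%N.
  rewrite /position /= (negbTE nby) eq_sym [x == b]eq_sym.
  case: (b == x); last by rewrite andbF; apply/esym/eqP; lia.
  by rewrite andbT -val_eqE /=; apply/eqP/eqP; lia.
have := chord_diff2_cut R n_gt0 i pos_lt.
have nyx : y == x = false by rewrite eq_sym (negbTE nxy).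
have -> : position (i, x) = i.*2 by rewrite /position /= eqxx.
have -> : position (ord_pred i, y) = (ord_pred i).*2.+2.
  by rewrite /position /= eqxx nyx.
rewrite /inner /= !eqxx nyx /= => cut.
set e := (_ *+ 2) in cut *; move: cut.
set c1 := chord _ _ _ _; set c2 := chord _ _ _ _.
set c3 := chord _ _ _ _; set c4 := chord _ _ _ _ => cut.
have {cut} -> : e = n%:R^-1 - (c1 + c2 - (c3 + c4)) by rewrite cut; ring.
by rewrite mulr0n; field; rewrite mR nR.
Qed.

Lemma sum_flower_resistance :
  \sum_p \sum_q flower_resistance (pi p) (pi q) =
  2 * n%:R ^+ 2 * (m%:R - 2) + m%:R * n%:R * (n%:R ^+ 2 - 1) / 3.
Proof.
rewrite exchange_big /=.
have pair_sum (F : 'I_n * 'I_m -> R) : \sum_p F p = \sum_i \sum_w F (i, w).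
  by rewrite pair_bigA; apply: eq_bigr => -[].
have sum_const k (c : R) : \sum_(i < k) c = k%:R * c.
  by rewrite sumr_const card_ord mulr_natl.
have row q : \sum_p flower_resistance (pi p) (pi q) =
    n%:R * ((m%:R - 2) / m%:R) + n%:R * (inner q)%:R - m%:R^-1
    + \sum_(i < n) chord R n i.*2.+1 (position q).
  under eq_bigr do rewrite flower_resistanceE.
  rewrite pair_sum; under eq_bigr do rewrite sum_copy_resistance.
  rewrite 3!big_split /= !sum_const; set c := \sum_i _; by field; rewrite mR nR.
under eq_bigr do rewrite row.
rewrite big_split /= exchange_big /=.
(* The final 1 is 2 - n / n: each copy contributes -1/n, and copy i an additional 2. *)
have odd_sum (i : 'I_n) : \sum_q chord R n i.*2.+1 (position q) =
    m%:R * ((n%:R ^+ 2 - 1) / 3) + 1.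
  rewrite pair_sum -(sum_chord_odd R n_gt0 i) mulr_sumr.
  transitivity (\sum_(j < n) (m%:R * chord R n i.*2.+1 j.*2.+1
      + (if j == i then 2 else 0) - n%:R^-1)).
    apply: eq_bigr => j _; under eq_bigr do rewrite chordC.
    rewrite sum_chord_copy chordC eqSS (inj_eq double_inj) val_eqE.
    by case: eqP; rewrite ?mul0rn.
  rewrite 2!big_split /= -big_mkcond big_pred1_eq sum_const.
  set c := \sum_j _; by field.
under [X in _ + X]eq_bigr do rewrite odd_sum.
rewrite sum_const pair_sum.
transitivity (n%:R * (n%:R * (m%:R - 2) + n%:R * (m%:R - 2) - 1)
    + n%:R * (m%:R * ((n%:R ^+ 2 - 1) / 3) + 1) : R).
  congr (_ + _); rewrite -[RHS](sum_const n); apply: eq_bigr => i _.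
  by rewrite 2!big_split /= -!mulr_sumr sum_inner_copy !sum_const; field.
by field.
Qed.
End CompleteFlower.

(** * Combining the edge count with the degree-weighted resistance sum *)

Theorem theorem4p6 (R : realFieldType) (m n : nat) (hm : (3 <= m)%N)
    (hn : (3 <= n)%N) (x y : complete_graph m) (hxy : x != y) :
  kemeny R (flower x y n) =
    ((m%:R - 1) * (- 12 * n%:R + m%:R * (n%:R ^+ 2 + 6 * n%:R - 1))) /
    (6 * m%:R).
Proof.
have [h laph] := lap_flower_resistance R hxy hn.
have resE (P Q : flower x y n) : resistance R P Q = flower_resistance R P Q.
  apply: resistance_kernel laph => *; last exact: flower_resistanceC.
  exact: flower_resistancexx.
have mR : m%:R != 0 :> R by rewrite pnatr_eq0; case: m hm {x y hxy laph resE h}.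
have nR : n%:R != 0 :> R by rewrite pnatr_eq0; case: n hn {x y hxy laph resE h}.
have m1R : m%:R - 1 != 0 :> R.
  by rewrite subr_eq0 pnatr_eq1; case: m hm {x y hxy laph resE h mR} => [|[]].
have natr_pred : m.-1%:R = m%:R - 1 :> R.
  by rewrite -subn1 natrB // (leq_trans _ hm).
have edgesE : 2 * #|edges (flower x y n)|%:R = n%:R * m%:R * (m%:R - 1) :> R.
  rewrite -natrM -sum_degree natr_sum.
  under eq_bigr do rewrite -[_%:R]mulr1.
  (* With weight 1, the degree sum runs over the nm pairs, each of degree m - 1. *)
  rewrite (sum_degree_flower hxy hn (fun=> 1)).
  under eq_bigr do rewrite degree_complete mulr1.
  by rewrite sumr_const card_prod !card_ord -[LHS]mulr_natl natrM natr_pred.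
have sumE : \sum_(P : flower x y n) \sum_(Q : flower x y n)
    (degree P)%:R * (degree Q)%:R * resistance R P Q =
    (m%:R - 1) ^+ 2 *
    (2 * n%:R ^+ 2 * (m%:R - 2) + m%:R * n%:R * (n%:R ^+ 2 - 1) / 3).
  rewrite -(sum_flower_resistance R hxy hn) mulr_sumr.
  (* The transfer to the disjoint copies is applied first to the sum over Q, then to the sum over
     P. *)
  under eq_bigr => P _.
    under eq_bigr do rewrite -mulrA resE.
    rewrite -mulr_sumr (sum_degree_flower hxy hn); over.
  rewrite (sum_degree_flower hxy hn); apply: eq_bigr => p _.
  rewrite !mulr_sumr; apply: eq_bigr => q _.
  by rewrite !degree_complete natr_pred; ring.
rewrite /kemeny sumE.
have -> : 4 * #|edges (flower x y n)|%:R = 2 * (n%:R * m%:R * (m%:R - 1)) :> R.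
  by rewrite -edgesE; ring.
by field; rewrite mR nR m1R.
Qed.
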